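(* Consider a system of $n$ qubits and a linear combination of single-element matrices $$E_\Sigma:=\sum_{\lambda=1}^m c_\lambda E^{(\lambda)}_{ij},\qquad c_\lambda\in\mathbb C,$$ where each $E^{(\lambda)}_{ij}$ is a $2^n\times2^n$ matrix unit $E_{i_\lambda j_\lambda}$ with $i_\lambda\neq j_\lambda$. Then $E_\Sigma$ is sign-invertible by an individual local $z$-rotation $K(\phi_1,\dots,\phi_n,F_z)$, i.e. $K E_\Sigma K^{-1}=-E_\Sigma$ for some such $K$, if there is at least one consistent set of rotation angles $\{\phi_\ell\in\mathbb R\mid \ell=1,\dots,n\}$ simultaneously satisfying, for all constituents $\lambda=1,\dots,m$, $$\sum_{\ell=1}^n p_{\lambda,\ell}\,\phi_\ell=\pm\pi\ (\mathrm{mod}\ 2\pi).$$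
   Context: $E_{ij}$ is the matrix with a single non-zero entry $1$ in row $i$, column $j$. $K(\phi_1,\dots,\phi_n,F_z):=\bigotimes_{\ell=1}^n e^{-i\phi_\ell\sigma_z/2}\in\mathbf{SU}(2)^{\otimes n}$ with $\sigma_z=\mathrm{diag}(1,-1)$. Every $2^n\times2^n$ matrix unit is uniquely a tensor product of $n$ two-by-two matrix units from $J^\alpha=\begin{pmatrix}1&0\\0&0\end{pmatrix}$, $J^\beta=\begin{pmatrix}0&0\\0&1\end{pmatrix}$, $J_+=\begin{pmatrix}0&1\\0&0\end{pmatrix}$, $J_-=\begin{pmatrix}0&0\\1&0\end{pmatrix}$; the number $p_{\lambda,\ell}$ is $0,0,+1,-1$ according to whether the $\ell$-th tensor factor of $E^{(\lambda)}_{ij}$ is $J^\alpha,J^\beta,J_+,J_-$, respectively. *)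

(* Defs.v *)
From HB Require Import structures.
From mathcomp Require Import all_boot all_order all_algebra.
From mathcomp Require Import all_classical all_reals all_analysis.
From mathcomp Require Import complex mxtens.

Set Implicit Arguments.
Unset Strict Implicit.
Unset Printing Implicit Defensive.

Import Order.TTheory GRing.Theory Num.Theory numFieldNormedType.Exports.

Local Open Scope classical_set_scope.
Local Open Scope ring_scope.
Local Open Scope complex_scope.

(* The limit is taken in the norm topology of the square matrices over [K]. *)
Definition expmx (K : numFieldType) (d : nat) (A : 'M[K]_d.+1) : 'M[K]_d.+1 :=
  lim (series (fun k : nat => (k`!%:R)^-1 *: A ^+ k) @ \oo).

(* [A 0] is the leftmost factor, so it acts on the most significant bit of
   the row and column indices. *)
Fixpoint bigtens (K : pzRingType) (n : nat) :
    ('I_n -> 'M[K]_2) -> 'M[K]_(2 ^ n) :=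
  match n return ('I_n -> 'M[K]_2) -> 'M[K]_(2 ^ n) with
  | 0 => fun _ => 1%:M
  | n'.+1 => fun A =>
      castmx (esym (expnS 2 n'), esym (expnS 2 n'))
        (A ord0 *t bigtens (fun l => A (lift ord0 l)))
  end.

Variant unit2 := Jalpha | Jbeta | Jplus | Jminus.

Definition unit2_code (u : unit2) : bool * bool :=
  match u with
  | Jalpha => (false, false) | Jbeta => (true, true)
  | Jplus => (false, true) | Jminus => (true, false)
  end.

Definition unit2_decode (ab : bool * bool) : unit2 :=
  match ab with
  | (false, false) => Jalpha | (true, true) => Jbeta
  | (false, true) => Jplus | (true, false) => Jminus
  end.

Lemma unit2_codeK : cancel unit2_code unit2_decode.
Proof. by case. Qed.

HB.instance Definition _ := Finite.copy unit2 (can_type unit2_codeK).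

Definition unit2_mx (K : pzRingType) (u : unit2) : 'M[K]_2 :=
  match u with
  | Jalpha => delta_mx 0 0
  | Jbeta => delta_mx 1 1
  | Jplus => delta_mx 0 1
  | Jminus => delta_mx 1 0
  end.

Definition unit2_p (u : unit2) : int :=
  match u with
  | Jalpha => 0
  | Jbeta => 0
  | Jplus => 1
  | Jminus => -1
  end.

(* The default value is never used: see [tens_factorsP], [tens_factors_uniq]. *)
Definition tens_factors (K : nzRingType) (n : nat) (i j : 'I_(2 ^ n)) :
    {ffun 'I_n -> unit2} :=
  odflt [ffun=> Jalpha]
    [pick u : {ffun 'I_n -> unit2} |
       bigtens (fun l => unit2_mx K (u l)) == delta_mx i j].

Lemma unit2_mxE (K : pzRingType) (a b : 'I_2) :
  exists u, unit2_mx K u = delta_mx a b.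
Proof.
have h (x : 'I_2) : (x = 0) \/ (x = 1).
  by case: x => [[|[|//]] p]; [left|right]; exact: val_inj.
by case: (h a) => ->; case: (h b) => ->;
  [exists Jalpha|exists Jplus|exists Jminus|exists Jbeta].
Qed.

Lemma tens_delta_mx (K : pzRingType) (p q : nat) (a b : 'I_p) (c d : 'I_q) :
  delta_mx a b *t delta_mx c d
  = delta_mx (mxtens_index (a, c)) (mxtens_index (b, d)) :> 'M[K]_(p * q).
Proof.
apply/matrixP => x y.
case: (mxtens_indexP x) => x0 x1; case: (mxtens_indexP y) => y0 y1.
rewrite tensmxE !mxE !(can_eq (@mxtens_indexK _ _)) !xpair_eqE.
by do 4!case: (_ == _); rewrite /= ?(mulr1, mulr0).
Qed.

Lemma cast_delta_mx (K : pzRingType) (p q : nat) (e : p = q) (a b : 'I_p) :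
  castmx (e, e) (delta_mx a b) = delta_mx (cast_ord e a) (cast_ord e b)
  :> 'M[K]_q.
Proof. by case: _ / e; rewrite castmx_id !cast_ord_id. Qed.

Lemma bigtens_unit_exists (K : pzRingType) (n : nat) (i j : 'I_(2 ^ n)) :
  exists u : {ffun 'I_n -> unit2},
    bigtens (fun l => unit2_mx K (u l)) = delta_mx i j.
Proof.
elim: n i j => [|n IHn] i j.
  exists [ffun=> Jalpha] => /=.
  apply/matrixP => x y; rewrite !mxE.
  have h (z t : 'I_(2 ^ 0)) : z = t.
    by case: z t => [[|//] ?] [[|//] ?]; exact: val_inj.
  by rewrite (h x y) (h i j) (h y j) !eqxx.
pose e := expnS 2 n.
rewrite -(cast_ordK e i) -(cast_ordK e j).
case: (mxtens_indexP (cast_ord e i)) => i0 i1.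
case: (mxtens_indexP (cast_ord e j)) => j0 j1.
have [u0 Hu0] := unit2_mxE K i0 j0; have [u1 Hu1] := IHn i1 j1.
exists [ffun l => if unlift ord0 l is Some l' then u1 l' else u0] => /=.
rewrite ffunE unlift_none Hu0.
under [fun l : 'I_n => _]eq_fun do rewrite ffunE liftK.
by rewrite Hu1 tens_delta_mx cast_delta_mx.
Qed.

Lemma tens_factorsP (K : nzRingType) (n : nat) (i j : 'I_(2 ^ n)) :
  bigtens (fun l => unit2_mx K (tens_factors K i j l)) = delta_mx i j.
Proof.
rewrite /tens_factors; case: pickP => [u /eqP //|no].
by have [u Hu] := bigtens_unit_exists K i j; move: (no u); rewrite Hu eqxx.
Qed.

Lemma bigtens_unit_delta (K : pzRingType) (n : nat) (u : 'I_n -> unit2) :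
  exists i j, bigtens (fun l => unit2_mx K (u l)) = delta_mx i j.
Proof.
elim: n u => [|n IHn] u.
  exists ord0, ord0; apply/matrixP => x y; rewrite !mxE /=.
  have h (z t : 'I_(2 ^ 0)) : z = t.
    by case: z t => [[|//] ?] [[|//] ?]; exact: val_inj.
  by rewrite (h x y) (h y ord0) !eqxx.
have [i1 [j1 /= ->]] := IHn (fun l => u (lift ord0 l)).
have [i0 [j0 ->]] : exists a b : 'I_2, unit2_mx K (u ord0) = delta_mx a b.
  by case: (u ord0); do 2!eexists.
by rewrite tens_delta_mx cast_delta_mx; do 2!eexists.
Qed.

Lemma delta_mx_inj (K : nzRingType) (p q : nat) (a c : 'I_p) (b d : 'I_q) :
  delta_mx a b = delta_mx c d :> 'M[K]_(p, q) -> a = c /\ b = d.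
Proof.
move=> /matrixP /(_ a b); rewrite !mxE !eqxx /=.
case: eqP => [->|_]; case: eqP => [->|_] // /eqP; by rewrite oner_eq0.
Qed.

Lemma tens_factors_uniq (K : nzRingType) (n : nat)
    (u v : {ffun 'I_n -> unit2}) :
  bigtens (fun l => unit2_mx K (u l)) = bigtens (fun l => unit2_mx K (v l)) ->
  u = v.
Proof.
suff gen : forall (u v : 'I_n -> unit2),
    bigtens (fun l => unit2_mx K (u l)) = bigtens (fun l => unit2_mx K (v l)) ->
    forall l, u l = v l.
  by move=> /gen H; apply/ffunP.
elim: n {u v} => [|n IHn] u v; first by move=> _ [].
move=> /= /(can_inj (castmxK _ _)).
have [i1 [j1 Eu]] := bigtens_unit_delta K (fun l => u (lift ord0 l)).
have [i1' [j1' Ev]] := bigtens_unit_delta K (fun l => v (lift ord0 l)).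
have D w : exists a b : 'I_2, unit2_mx K w = delta_mx a b.
  by case: w; do 2!eexists.
have [i0 [j0 Eu0]] := D (u ord0); have [i0' [j0' Ev0]] := D (v ord0).
rewrite /= Eu Ev Eu0 Ev0 !tens_delta_mx => /delta_mx_inj[].
move=> /(can_inj (@mxtens_indexK _ _))[ei0 ei1].
move=> /(can_inj (@mxtens_indexK _ _))[ej0 ej1].
subst i0' i1' j0' j1' => l.
case: (unliftP ord0 l) => [l' ->|->].
  by apply: (IHn (fun l => u (lift ord0 l)) (fun l => v (lift ord0 l))); rewrite Eu Ev.
move: (etrans Eu0 (esym Ev0)).
by case: (u ord0); case: (v ord0) => //= /delta_mx_inj[].
Qed.

Definition p_coef (K : nzRingType) (n : nat) (i j : 'I_(2 ^ n)) (l : 'I_n) :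
  int := unit2_p (tens_factors K i j l).

Definition sigma_z (K : pzRingType) : 'M[K]_2 :=
  diag_mx (\row_(a < 2) (if a == 0 then 1 else -1)).

Definition local_zrot (R : realType) (n : nat) (phi : 'I_n -> R) :
    'M[R[i]]_(2 ^ n) :=
  bigtens (fun l => expmx (- ('i * (phi l)%:C / 2) *: sigma_z R[i])).

Definition sign_invertible_by_local_zrot (R : realType) (n : nat)
    (E : 'M[R[i]]_(2 ^ n)) : Prop :=
  exists phi : 'I_n -> R,
    local_zrot phi *m E *m invmx (local_zrot phi) = - E.

Definition eqmod2pi (R : realType) (x y : R) : Prop :=
  exists k : int, x = y + k%:~R * (2 * pi).

(* Main.v *)
(* Conjugation by K acts factorwise on tensor products: K_l fixes J^alpha and
   J^beta and multiplies J_+ and J_- by e^{-i phi_l} and e^{i phi_l}.  Hence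
   every matrix unit is an eigenvector of conjugation by K, with eigenvalue
   e^{-i S}, where S is the sum of the p_l phi_l; the condition on the angles
   says that this eigenvalue is -1. *)
Require Import Defs.
From mathcomp Require Import all_boot all_order all_algebra.
From mathcomp Require Import all_classical all_reals all_analysis.
From mathcomp Require Import complex mxtens ring.

Import Order.TTheory GRing.Theory Num.Theory numFieldNormedType.Exports.

Local Open Scope ring_scope.
Local Open Scope complex_scope.

Lemma castmx_mul (K : pzSemiRingType) (p q : nat) (e : p = q) (A B : 'M[K]_p) :
  castmx (e, e) (A *m B) = castmx (e, e) A *m castmx (e, e) B.
Proof. by case: q / e; rewrite !castmx_id. Qed.

Lemma castmx_scale (K : pzSemiRingType) (p q : nat) (e : p = q) (a : K)
    (A : 'M[K]_p) :
  castmx (e, e) (a *: A) = a *: castmx (e, e) A.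
Proof. by case: q / e; rewrite !castmx_id. Qed.

Lemma tensmx_scale (K : comPzRingType) (m n p q : nat) (a b : K)
    (A : 'M[K]_(m, n)) (B : 'M[K]_(p, q)) :
  (a *: A) *t (b *: B) = (a * b) *: (A *t B).
Proof. by apply/matrixP => x y; rewrite !mxE mulrACA. Qed.

Lemma bigtens_mul (K : comPzRingType) (n : nat) (A B : 'I_n -> 'M[K]_2) :
  bigtens A *m bigtens B = bigtens (fun l => A l *m B l).
Proof.
elim: n A B => [|n IHn] A B /=; first by rewrite mulmx1.
by rewrite -castmx_mul tensmx_mul IHn.
Qed.

Lemma bigtens_scale (K : comPzRingType) (n : nat) (a : 'I_n -> K)
    (A : 'I_n -> 'M[K]_2) :
  bigtens (fun l => a l *: A l) = (\prod_(l < n) a l) *: bigtens A.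
Proof.
elim: n a A => [|n IHn] a A /=; first by rewrite big_ord0 scale1r.
by rewrite IHn tensmx_scale castmx_scale big_ord_recl.
Qed.

(** Makes factorwise inverses into an inverse of the whole tensor product. Two indices agree exactly
    when their leading bits and their remaining parts agree. *)
Lemma bigtens1 (K : pzRingType) (n : nat) :
  bigtens (fun _ : 'I_n => 1%:M) = 1%:M :> 'M[K]_(2 ^ n).
Proof.
elim: n => [//|n IHn] /=; rewrite IHn.
apply/matrixP => x y; rewrite castmxE !mxE !esymK.
pose e := expnS 2 n; rewrite -(cast_ordK e x) -(cast_ordK e y).
case: (mxtens_indexP (cast_ord e x)) => x0 x1.
case: (mxtens_indexP (cast_ord e y)) => y0 y1.
rewrite !cast_ordKV !mxtens_indexK.
rewrite (can_eq (cast_ordKV e)) (can_eq (@mxtens_indexK _ _)) xpair_eqE.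
by do 2!case: (_ == _); rewrite /= ?(mulr1, mulr0).
Qed.

Section ComplexExponential.

Variable R : realType.
Implicit Types t s : R.
(* The topology of [R[i]] is only inferred through its [numFieldType]
   structure. *)
Local Notation C := (Num.NumField.sort R[i]).

(** Euler's form of $e^{it}$, so that its functional equations come from real trigonometry;
    [cvg_series_imaginary_exp] ties it to the power series. *)
Definition expi t : R[i] := cos t +i* sin t.

Lemma expi0 : expi 0 = 1.
Proof. by rewrite /expi cos0 sin0. Qed.

Lemma expiD t s : expi (t + s) = expi t * expi s.
Proof. by rewrite /expi cosD sinD; simpc; congr (_ +i* _); rewrite addrC. Qed.

Lemma expi_sum (n : nat) (F : 'I_n -> R) :
  expi (\sum_(l < n) F l) = \prod_(l < n) expi (F l).
Proof. exact: (big_morph expi expiD expi0). Qed.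

Lemma expiDpi t : expi (t + pi) = - expi t.
Proof. by rewrite /expi cosDpi sinDpi. Qed.

Lemma expiD2piz t (k : int) : expi (t + k%:~R * (2 * pi)) = expi t.
Proof.
have pn s (n : nat) : expi (s + n%:R * (2 * pi)) = expi s.
  elim: n => [|n IHn]; first by rewrite mul0r addr0.
  (* A full turn is two half turns, whose sign changes cancel. *)
  have -> : s + n.+1%:R * (2 * pi) = s + n%:R * (2 * pi) + pi + pi.
    by rewrite -natr1; ring.
  by rewrite !expiDpi opprK.
case: k => n; first exact: pn.
(* For $k = -(n+1)$, the natural case is used backwards: adding $n+1$ turns to the shifted angle
   gives back $t$. *)
by rewrite NegzE -(pn _ n.+1) mulrNz mulNr subrK.
Qed.

Lemma normc_real t : `|t%:C| = `|t|%:C.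
Proof. by rewrite normc_def /= expr0n addr0 sqrtr_sqr. Qed.

Lemma real_complex_continuous : continuous (fun t : R => t%:C : C).
Proof.
move=> t; apply/cvgrPdist_lt => e e0.
(* A positive element of [R[i]] is real, so its real part can serve as the tolerance in [R]. *)
have eR : e = (complex.Re e)%:C by rewrite RRe_real // gtr0_real.
have : 0 < complex.Re e by rewrite -ltcR -eR.
move=> e0'; near=> s; rewrite eR -rmorphB /= normc_real ltcR.
by near: s; exact: cvgr_dist_lt.
Unshelve. all: by end_near. Qed.

(** Euler's formula term by term: since $i^{2m} = (-1)^m$, even powers give the cosine series and
    odd powers give $i$ times the sine series. *)
Lemma imaginary_exp_coeff t (k : nat) :
  (k`!%:R)^-1 * ('i * t%:C) ^+ k
  = (cos_coeff t k)%:C + 'i * (sin_coeff t k)%:C :> R[i].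
Proof.
have i2 m : 'i ^+ m.*2 = ((-1) ^+ m)%:C :> R[i].
  by rewrite -mul2n exprM sqr_i rmorphXn /= rmorphN1.
rewrite -(odd_double_half k); case: (odd k); rewrite ?add0n ?add1n.
  rewrite cos_coeff_odd /sin_coeff /= odd_double /= doubleK mul1r add0r.
  rewrite exprMn exprS i2 -rmorphXn mulrC.
  rewrite !rmorphM /= fmorphV rmorph_nat /=.
  by rewrite !mulrA.
rewrite sin_coeff_even /cos_coeff /= odd_double /= doubleK mul1r mulr0 addr0.
rewrite exprMn i2 -rmorphXn mulrC -exprnP.
by rewrite !rmorphM /= fmorphV rmorph_nat.
Qed.

Lemma cvg_series_imaginary_exp t :
  (series (fun k : nat => (k`!%:R)^-1 * ('i * t%:C : C) ^+ k) @ \oo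
     --> (expi t : C))%classic.
Proof.
have real_cvg (u : R ^nat) (l : R) : (u @ \oo --> l)%classic ->
    ((fun n => (u n)%:C : C) @ \oo --> (l%:C : C))%classic.
  by move=> ul; exact: (cvg_comp _ _ ul (real_complex_continuous l)).
have /real_cvg cos_cvg : (series (cos_coeff t) @ \oo --> cos t)%classic.
  (* Unlocking exposes [cos] as the limit of its series, so convergence of the series is enough. *)
  by rewrite unlock; exact: is_cvg_series_cos_coeff.
have /real_cvg sin_cvg : (series (sin_coeff t) @ \oo --> sin t)%classic.
  by rewrite unlock; exact: is_cvg_series_sin_coeff.
rewrite (_ : series _ = fun n => (series (cos_coeff t) n)%:C
                             + 'i * (series (sin_coeff t) n)%:C); last first.
  apply/funext => n; rewrite /series /=.
  under eq_bigr do rewrite imaginary_exp_coeff.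
  by rewrite big_split /= -mulr_sumr !rmorph_sum.
rewrite [expi t]complexE.
exact: (cvgD cos_cvg (cvgM (@cvg_cst C 'i _ _ _) sin_cvg)).
Qed.

End ComplexExponential.
Arguments expi {R} t.

Lemma diag_mx_exp (K : pzRingType) (d : nat) (a : 'rV[K]_d.+1) (k : nat) :
  diag_mx a ^+ k = diag_mx (\row_l a 0 l ^+ k).
Proof.
elim: k => [|k IHk].
  apply/matrixP => x y; rewrite expr0 !mxE expr0; by case: eqP.
rewrite exprS IHk -mulmxE mulmx_diag; congr diag_mx.
by apply/rowP => l; rewrite !mxE exprS.
Qed.

(** A matrix neighbourhood contains a product of entrywise ones, and finitely many eventual
    conditions hold together eventually. *)
Lemma cvg_mx (K : numFieldType) (p q : nat) (u : nat -> 'M[K]_(p, q))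
    (M : 'M[K]_(p, q)) :
  (forall x y, (fun n => u n x y) @ \oo --> M x y)%classic ->
  (u @ \oo --> M)%classic.
Proof.
move=> uM A [P PM PA].
have : (\forall n \near \oo, forall x y, P x y (u n x y))%classic.
  by apply: filter_forall => x; apply: filter_forall => y; exact: uM.
by apply: filterS => n; exact: PA.
Qed.

Lemma expmx_diag (K : numFieldType) (d : nat) (a e : 'rV[K]_d.+1) :
  (forall l, series (fun k : nat => (k`!%:R)^-1 * a 0 l ^+ k) @ \oo
     --> e 0 l)%classic ->
  expmx (diag_mx a) = diag_mx e.
Proof.
move=> ae; apply: cvg_lim; first exact: norm_hausdorff.
apply: cvg_mx => x y.
rewrite (_ : (fun n => _) = fun n =>
    series (fun k : nat => (k`!%:R)^-1 * a 0 x ^+ k) n *+ (x == y)).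
  rewrite mxE; case: eqP => _; first exact: ae.
  (* Off the diagonal every partial sum is zero. *)
  exact: cvg_cst.
apply/funext => n; rewrite /series /= summxE -sumrMnl.
by apply: eq_bigr => k _; rewrite diag_mx_exp !mxE mulrnAr.
Qed.

Definition zrot {R : realType} (t : R) : 'M[R[i]]_2 :=
  diag_mx (\row_(a < 2) expi (if a == 0 then - (t / 2) else t / 2)).

Lemma expmx_zrot (R : realType) (t : R) :
  expmx (- ('i * t%:C / 2) *: sigma_z R[i]) = zrot t.
Proof.
rewrite /sigma_z -linearZ /=; apply: expmx_diag => l.
rewrite !mxE; set s := if _ then - (t / 2) else _.
rewrite (_ : - _ * _ = 'i * s%:C); first exact: cvg_series_imaginary_exp.
have t2E : (t / 2)%:C = t%:C / 2 :> R[i] by rewrite rmorphM fmorphV rmorph_nat.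
rewrite /s; case: (l == 0); first by rewrite rmorphN /= t2E mulr1 mulrN mulrA.
by rewrite t2E mulrNN mulr1 mulrA.
Qed.

Lemma zrotV (R : realType) (t : R) : zrot t *m zrot (- t) = 1%:M.
Proof.
rewrite mulmx_diag -diag_const_mx; congr diag_mx; apply/rowP => l.
rewrite !mxE mulNr -expiD; case: (l == 0).
  by rewrite opprK addNr expi0.
by rewrite subrr expi0.
Qed.

(** The entry $(a,b)$ is scaled by the $a$-th diagonal phase times the inverse of the $b$-th: the
    half angles cancel if $a = b$ and add up to a whole angle otherwise. *)
Lemma zrot_conj (R : realType) (t : R) (u : unit2) :
  zrot t *m unit2_mx R[i] u *m zrot (- t)
  = expi (- ((unit2_p u)%:~R * t)) *: unit2_mx R[i] u.
Proof.
have half : t / 2 + t / 2 = t by rewrite -splitr.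
have prodE a b : zrot t *m delta_mx a b *m zrot (- t)
    = (expi (if a == 0 then - (t / 2) else t / 2)
       * expi (if b == 0 then - (- t / 2) else - t / 2)) *: delta_mx a b.
  apply/matrixP => x y; rewrite mul_diag_mx mul_mx_diag !mxE.
  case: (x =P a) => [->|_]; case: (y =P b) => [->|_] /=;
    by rewrite ?(mulr1, mulr0, mul0r).
case: u => /=; rewrite prodE -expiD /= mulNr ?opprK; congr (expi _ *: _).
- by rewrite mul0r oppr0 addNr.
- by rewrite mul0r oppr0 subrr.
- by rewrite mul1r -opprD half.
- by rewrite mulN1r opprK half.
Qed.

Theorem proposition2 (R : realType) (n m : nat)
    (c : 'I_m -> R[i]) (i j : 'I_m -> 'I_(2 ^ n))
    (hij : forall la : 'I_m, i la <> j la)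
    (hphi : exists phi : 'I_n -> R, forall la : 'I_m,
        let S := \sum_(l < n) (p_coef R[i] (i la) (j la) l)%:~R * phi l in
        eqmod2pi S pi \/ eqmod2pi S (- pi)) :
  sign_invertible_by_local_zrot
    (\sum_(la < m) c la *: delta_mx (i la) (j la) : 'M[R[i]]_(2 ^ n)).
Proof.
have [phi phiE] := hphi; exists phi.
have -> : local_zrot phi = bigtens (fun l => zrot (phi l)).
  by congr bigtens; apply/funext => l; exact: expmx_zrot.
set K := bigtens _; pose K' := bigtens (fun l => zrot (- phi l)).
have KK' : K *m K' = 1%:M.
  rewrite bigtens_mul -[RHS]bigtens1.
  by congr bigtens; apply/funext => l; exact: zrotV.
(* For square matrices a right inverse already forces [K] to be a unit. *)
have -> : invmx K = K'.
  have [Ku _] := mulmx1_unit KK'.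
  by rewrite -[LHS]mulmx1 -KK' mulKmx.
(* Conjugation is linear, so each matrix unit can be treated separately. *)
rewrite mulmx_sumr mulmx_suml -sumrN; apply: eq_bigr => la _.
rewrite -scalemxAr -scalemxAl -scalerN; congr (_ *: _).
rewrite -(tens_factorsP R[i] (i la) (j la)) !bigtens_mul.
under [fun l : 'I_n => _]eq_fun do rewrite zrot_conj.
rewrite bigtens_scale -expi_sum sumrN -scaleN1r; congr (_ *: _).
have := phiE la; rewrite /p_coef /=; set S := \sum_l _.
have expipi : expi (- pi : R) = -1.
  by rewrite -[LHS]opprK -expiDpi addNr expi0.
(* The phase is that of $-S$: its whole turns drop out, leaving $-\pi$ or $\pi$, both with
   exponential $-1$. *)
by move=> [] [k ->]; rewrite opprD -mulNr -mulrNz expiD2piz ?opprK //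
  -[pi]add0r expiDpi expi0.
Qed.
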